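(* Let $k$ and $n$ be non-negative integers and let $m,\alpha,\beta\ge 1$ be integers with $2\nmid\alpha$. Let $p\ge 3$ be a prime such that $p\equiv 3\pmod 4$. Let $r$ be a non-negative integer such that $p$ divides $4r+3$. Then $$\bar a_{2^m\alpha}\left(4p^{k+1}n+4pr+3p\right)\equiv p^2\,\bar a_{2^m\alpha}\left(4p^{k-1}n+\frac{4r+3}{p}\right)\pmod{2^{m+2}},$$ $$\bar a_{2\beta+1}\left(4p^{k+1}n+4pr+3p\right)\equiv p^2\,\bar a_{2\beta+1}\left(4p^{k-1}n+\frac{4r+3}{p}\right)\pmod 4.$$
   Context: For integers $\ell\ge1$ write $f_\ell=\prod_{j\ge 1}(1-q^{\ell j})$. For a positive integer $s$, $\bar a_s(n)$ denotes the number of partitions of $n$ in which each odd part occurs in one of $s$ colors and the first occurrence of each part (parts of the same size but different colors being distinct) may be overlined. Equivalently, $$\sum_{n\ge0}\bar a_s(n)q^n=\frac{f_2^{3s-2}}{f_1^{2s}f_4^{s-1}}.$$ Convention: $\bar a_s(x)=0$ if $x$ is not a non-negative integer (this is relevant only when $k=0$ and $p\nmid n$). *)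

(* Defs.v *)
From mathcomp Require Import all_boot all_order all_algebra.

Set Implicit Arguments.
Unset Strict Implicit.
Unset Printing Implicit Defensive.

Import GRing.Theory Num.Theory.

Definition ncolors (s j : nat) : nat := if odd j then s else 1.

(* Kinds of parts (size and color) that can occur in a partition of [n]: the
   index [i : 'I_n] stands for the part size [i.+1], so that sizes range over
   1, ..., n. *)
Definition part_kind (s n : nat) : finType :=
  {i : 'I_n & 'I_(ncolors s i.+1)}.

Definition part_size (s n : nat) (x : part_kind s n) : nat := (tag x).+1.

(* A colored overpartition of [n] assigns to each kind of part its
   multiplicity, at most [n], and a flag telling whether its first occurrence
   is overlined, which requires the kind to occur at all. *)
Definition is_overpartition (s n : nat)
    (pi : {ffun part_kind s n -> 'I_n.+1 * bool}) : bool :=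
  [forall x, (pi x).2 ==> (0 < (pi x).1)%N]
  && (\sum_x (pi x).1 * part_size x == n)%N.

Definition abar (s n : nat) : nat :=
  #|[set pi : {ffun part_kind s n -> 'I_n.+1 * bool} | is_overpartition pi]|.

(* Extension of [abar s] by 0 outside the non-negative integers. *)
Definition abarQ (s : nat) (x : rat) : nat :=
  if x \is a Num.nat then abar s (Num.truncn x) else 0%N.

(* Main.v *)
(** With [Y_j = q^j / (1 - q^j)], the generating function of [abar s] is the
    product over [j] of [(1 + 2 Y_j)^(s_j)], where [s_j = s] for odd [j] and
    [s_j = 1] for even [j].  If [2^m] exactly divides [s], [m > 0] and
    [e = m + 1], then [(1 + 2 y)^s = 1 + 2^e (y + y^2)] modulo [2^(e+1)];
    if [s] is odd and [e = 1], then [(1 + 2 y)^s = 1 + 2^e y] modulo [2^(e+1)].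
    The even factors form a series in [q^2] which is 1 modulo 2, and squares
    have even coefficients in odd degree.  So for odd [N], [abar s N] is
    [2^e] times the number of divisors of [N], modulo [2^(e+1)], that is, [2^e]
    if [N] is a square and 0 otherwise.  The argument on the left is [N = p^2 x],
    where [x] is the rational argument on the right: if [x] is an integer, then
    [N] is a square exactly when [x] is; otherwise [p] divides [N] exactly once
    and [N] is not a square. *)
Require Import Defs.
From mathcomp Require Import all_boot all_order all_algebra.
From mathcomp Require Import ring zify.

Set Implicit Arguments.
Unset Strict Implicit.
Unset Printing Implicit Defensive.

Import Order.TTheory GRing.Theory Num.Theory.

(** * Generating function modulo 2^(e+1) *)

Section GeneratingFunction.
Local Open Scope ring_scope.
Variable R : comNzRingType.

(* [Y_j], truncated; the terms of degree above [n] play no role. *)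
Definition geom (n j : nat) : {poly R} := \sum_(a < n) 'X^(a.+1 * j).

Lemma coef_geom n j : (0 < j)%N -> (0 < n)%N -> (geom n j)`_n = (j %| n)%:R.
Proof.
move=> j0 n0; rewrite coef_sum.
under eq_bigr do rewrite coefXn.
case: (boolP (j %| n)%N) => [/dvdnP[a na]|nj]; last first.
  rewrite big1 // => a _; case: eqP => // na.
  by rewrite na dvdn_mull in nj.
have [a' Ea] : exists a', a = a'.+1 by case: a na => [|a']; [lia | exists a'].
have lt_a : (a' < n)%N by nia.
rewrite (bigD1 (Ordinal lt_a)) //= -Ea -na eqxx big1 ?addr0 // => b.
rewrite -val_eqE /= => ba; case: eqP => // nb.
by case/negP: ba; apply/eqP; nia.
Qed.

Lemma geom_double n j : geom n (2 * j) = geom n j \Po 'X^2.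
Proof.
rewrite /geom raddf_sum; apply: eq_bigr => a _.
by rewrite /= comp_Xn_poly -exprM mulnCA.
Qed.

(** Expanding the product picks one pair (multiplicity, overline flag) for each kind of part, that
    is, one candidate overpartition. *)
Lemma abar_coef s n :
  (abar s n)%:R =
  (\prod_(i < n) (1 + geom n i.+1 *+ 2) ^+ ncolors s i.+1)`_n :> R.
Proof.
pose Q (v : 'I_n.+1 * bool) := v.2 ==> (0 < v.1)%N.
pose F (x : part_kind s n) (v : 'I_n.+1 * bool) : {poly R} :=
  'X^(v.1 * part_size x).
(* Multiplicity 0 admits no overline and gives 1; each positive multiplicity counts twice, overlined
   or not. *)
have FE x : 1 + geom n (part_size x) *+ 2 = \sum_(v | Q v) F x v.
  rewrite -(pair_big_dep predT (fun a b => b ==> (0 < val a)%N)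
    (fun a b => F x (a, b))) /= big_ord_recl /F /=.
  rewrite big_mkcond /= big_bool /= add0r expr0; congr (_ + _).
  rewrite /geom -sumrMnl; apply: eq_bigr => a _.
  by rewrite big_mkcond big_bool.
transitivity ((\prod_x (1 + geom n (@part_size s n x) *+ 2))`_n); last first.
  congr (_`_n); rewrite -(sig_big_dep (I := 'I_n) predT (fun _ _ => true)
    (fun i (_ : 'I_(ncolors s i.+1)) => 1 + geom n i.+1 *+ 2)) /=.
  by under eq_bigr do rewrite prodr_const card_ord.
under eq_bigr do rewrite FE.
rewrite bigA_distr_big coef_sum.
under eq_bigr => f _ do rewrite /F -expr_sum coefXn.
rewrite -natr_sum; congr _%:R.
rewrite /abar -sum1_card big_mkcond [RHS]big_mkcond; apply: eq_bigr => f _.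
rewrite inE /is_overpartition [n == _]eq_sym.
have -> : (f \in ffun_on Q) = [forall x, (f x).2 ==> (0 < (f x).1)%N] by [].
by case: [forall x, _]; case: (_ == n).
Qed.

(** Only cross terms reach odd degree, and they come in equal pairs. *)
Lemma dvd2_coef_sqr (f : {poly R}) n : odd n ->
  exists c : R, (f ^+ 2)`_n = c *+ 2.
Proof.
elim/poly_ind: f n => [|f c IH] n on; first by exists 0; rewrite expr0n coef0 mul0rn.
have -> : (f * 'X + c%:P) ^+ 2 = f ^+ 2 * 'X * 'X + (c *: f * 'X) *+ 2 + (c ^+ 2)%:P.
  by rewrite polyC_exp -mul_polyC; ring.
have [b Eb] : exists b, (f ^+ 2 * 'X * 'X)`_n = b *+ 2.
  case: n on => [|[|n]] //= on; first by exists 0; rewrite !coefMX mul0rn.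
  by rewrite !coefMX /=; apply: IH; rewrite negbK in on.
exists (b + (c *: f * 'X)`_n).
rewrite coefD coefD Eb coefMn coefC; case: n on {Eb} => // n _.
by rewrite addr0 mulrnDl.
Qed.

Lemma prod_even_factors n (r : seq 'I_n) :
  exists A T : {poly R},
    \prod_(i <- r | ~~ odd i.+1) (1 + geom n i.+1 *+ 2) = A \Po 'X^2 /\
    A \Po 'X^2 = 1 + T *+ 2.
Proof.
elim: r => [|i r [A [T [E1 E2]]]].
  by exists 1, 0; rewrite big_nil mul0rn addr0 comp_polyC.
rewrite big_cons; case: ifP => [oi|_]; last by exists A, T.
have Ei : i.+1 = (2 * (i.+1)./2)%N by rewrite mul2n even_halfK.
pose g := geom n (i.+1)./2.
exists ((1 + g *+ 2) * A), (geom n i.+1 * (1 + T *+ 2) + T).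
rewrite E1 comp_polyM E2 rmorphD rmorph1 rmorphMn /= -geom_double -Ei.
by split => //; ring.
Qed.

(** The scalar [c] lets one proof serve both parities of [s]: it is 1 for even [s] and 0 for odd
    [s]. The term in [c] drops out because odd coefficients of a square are even. *)
Lemma abar_odd (e s n : nat) (c : R) :
  (2 ^ e.+1)%:R = 0 :> R -> (0 < e)%N -> odd n ->
  (forall y : {poly R}, (1 + y *+ 2) ^+ s = 1 + (y + c *: y ^+ 2) *+ 2 ^ e) ->
  (abar s n)%:R = (\sum_(i < n) (i.+1 %| n))%:R *+ 2 ^ e :> R.
Proof.
move=> R0 e0 on pow_s.
have P0 (x : R) : x *+ 2 ^ e.+1 = 0 by rewrite -mulr_natr R0 mulr0.
have Q0 (x : {poly R}) : x *+ 2 ^ e.+1 = 0.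
  by apply/polyP => i; rewrite coefMn P0 coef0.
have -> : (abar s n)%:R =
    ((\prod_(i < n | odd i.+1) (1 + geom n i.+1 *+ 2) ^+ ncolors s i.+1) *
     \prod_(i < n | ~~ odd i.+1) (1 + geom n i.+1 *+ 2) ^+ ncolors s i.+1)`_n.
  by rewrite abar_coef (bigID (fun i : 'I_n => odd i.+1)).
have [A [T [EA ET]]] := prod_even_factors (index_enum 'I_n).
pose z (i : 'I_n) := geom n i.+1 + c *: geom n i.+1 ^+ 2.
have -> : \prod_(i < n | odd i.+1) (1 + geom n i.+1 *+ 2) ^+ ncolors s i.+1 =
    1 + (\sum_(i < n | odd i.+1) z i) *+ 2 ^ e.
  rewrite (eq_bigr (fun i => 1 + z i *+ 2 ^ e)); last first.
    by move=> i oi; rewrite /ncolors oi pow_s.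
  elim/big_rec2: _ => [|i p q oi ->]; first by rewrite mul0rn addr0.
  (* Cross terms carry 2^(2e), which vanishes since 2e >= e + 1. *)
  rewrite mulrDl mul1r mulrDr mulr1 mulrnAl mulrnAr -mulrnA -expnD.
  rewrite (_ : 2 ^ (e + e) = 2 ^ e.+1 * 2 ^ e.-1)%N; last first.
    by rewrite -expnD; congr (2 ^ _)%N; lia.
  by rewrite mulrnA Q0 mul0rn addr0 -addrA -mulrnDl [p + _]addrC.
have -> : \prod_(i < n | ~~ odd i.+1) (1 + geom n i.+1 *+ 2) ^+ ncolors s i.+1 =
    A \Po 'X^2.
  by rewrite -EA; apply: eq_bigr => i oi; rewrite /ncolors (negbTE oi) expr1.
set S := \sum_(i < n | _) _.
have -> : (1 + S *+ 2 ^ e) * (A \Po 'X^2) = A \Po 'X^2 + S *+ 2 ^ e.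
  rewrite mulrDl mul1r {2}ET mulrDr mulr1 mulrnAl mulrnAr -mulrnA -expnS.
  by rewrite Q0 addr0.
rewrite coefD coef_comp_poly_Xn // dvdn2 on /= add0r coefMn coef_sum.
rewrite -sumrMnl natr_sum -sumrMnl [RHS]big_mkcond /= [LHS]big_mkcond /=.
(* An odd [n] has no even divisors, so restricting to odd sizes loses none. *)
apply: eq_bigr => i _; case: ifP => oi; last first.
  case: (boolP (i.+1 %| n)%N) => [dn|_]; last by rewrite mul0rn.
  by move: (dvdn_odd dn on); rewrite /= oi.
rewrite coefD coefZ coef_geom // ?odd_gt0 //.
have [b ->] := dvd2_coef_sqr (geom n i.+1) on.
by rewrite mulrnDl mulrnAr -[c * b *+ 2 *+ _]mulrnA -expnS P0 addr0.
Qed.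

End GeneratingFunction.

(** * Parity of the number of divisors *)

Definition ndiv n := \sum_(i < n) (i.+1 %| n).

Lemma ndiv_oddP n : 0 < n -> reflect (exists x, n = x ^ 2) (odd (ndiv n)).
Proof.
case: n => // n _; pose N := n.+1.
have -> : ndiv N = \sum_(i < N | i.+1 %| N) 1 by rewrite [RHS]big_mkcond.
(* Pairing [d] with [N / d] leaves only the square root of [N] unpaired. *)
pose co (i : 'I_N) : 'I_N := inord (N %/ i.+1).-1.
have coE (i : 'I_N) : i.+1 %| N -> ((co i).+1 * i.+1)%N = N.
  move=> iN; have q0 : 0 < N %/ i.+1 by rewrite divn_gt0 // ltn_ord.
  rewrite /co inordK; first by rewrite prednK // divnK.
  by rewrite prednK // leq_div.
have coD (i : 'I_N) : i.+1 %| N -> (co i).+1 %| N.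
  by move=> iN; apply/dvdnP; exists i.+1; rewrite mulnC coE.
have coK (i : 'I_N) : i.+1 %| N -> co (co i) = i.
  move=> iN; apply/val_inj/eqP; rewrite /= -eqSS.
  by rewrite -(@eqn_pmul2r (co i).+1) // coE ?coD // mulnC coE.
have half : \sum_(i < N | (i.+1 %| N) && (N < i.+1 ^ 2)) 1 =
            \sum_(i < N | (i.+1 %| N) && (i.+1 ^ 2 < N)) 1.
  rewrite (reindex_onto co co) => [|i /andP[iN _]]; last exact: coK.
  apply: eq_bigl => i; apply/idP/idP.
    case/andP => /andP[ciN lt /eqP ciE].
    move: (coE _ ciN) (coD _ ciN); rewrite ciE => E -> /=.
    by move: lt; rewrite -{1}E -mulnn ltn_pmul2r // => lt; nia.
  case/andP => iN lt; have E := coE _ iN.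
  rewrite coK // eqxx andbT coD //=.
  by nia.
rewrite (bigID (fun i : 'I_N => N < i.+1 ^ 2)) /= half.
rewrite [X in _ + X](bigID (fun i : 'I_N => i.+1 ^ 2 < N)) /=.
set a := \sum_(i < N | _) 1; set b := \sum_(i < N | _) 1.
have -> : b = a.
  by apply: eq_bigl => i; rewrite -andbA; congr (_ && _); lia.
rewrite addnA addnn oddD odd_double /=.
rewrite (eq_bigl (fun i : 'I_N => i.+1 ^ 2 == N)); last first.
  move=> i; apply/idP/idP; first by lia.
  by move=> /eqP E; rewrite E ltnn !andbT; apply/dvdnP; exists i.+1; rewrite mulnn E.
case: (pickP (fun i : 'I_N => i.+1 ^ 2 == N)) => [i /eqP Ei|no].
  rewrite (bigD1 i) ?Ei //= big1 => [|j /andP[/eqP Ej]].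
    by apply: ReflectT; exists i.+1.
  by rewrite -val_eqE /=; nia.
rewrite big_pred0 //=; apply: ReflectF => -[[|x] // Ex].
have xN : x < N by rewrite /N; nia.
by move: (no (Ordinal xN)); rewrite /= -Ex eqxx.
Qed.

Lemma odd_ndiv_sqrM p n : 0 < p -> 0 < n -> odd (ndiv (p ^ 2 * n)) = odd (ndiv n).
Proof.
move=> p0 n0; have pn0 : 0 < p ^ 2 * n by rewrite muln_gt0 expn_gt0 p0.
apply/(ndiv_oddP pn0)/(ndiv_oddP n0) => -[x Ex]; last first.
  by exists (p * x); rewrite Ex expnMn.
have /dvdnP[y Ey] : p %| x by rewrite -(@dvdn_pexp2r _ _ 2) // -Ex dvdn_mulr.
exists y; apply/eqP; rewrite -(@eqn_pmul2l (p ^ 2)) ?expn_gt0 ?p0 //.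
by rewrite Ex Ey -expnMn mulnC.
Qed.

Lemma even_ndiv p n : prime p -> 0 < n -> p %| n -> ~~ (p ^ 2 %| n) ->
  ~~ odd (ndiv n).
Proof.
move=> pp n0 pn; apply: contraNN => /(ndiv_oddP n0)[x Ex].
rewrite Ex dvdn_exp2r //.
by move: pn; rewrite Ex Euclid_dvdX // => /andP[].
Qed.

(** * Powers of 1 + 2y modulo powers of 2 *)

Section PowerExpansions.
Local Open Scope ring_scope.
Variables (A : comNzRingType).

Lemma pow2_expansion m (y : A) : (0 < m)%N -> exists t,
  (1 + y *+ 2) ^+ (2 ^ m) = 1 + (y + y ^+ 2) *+ 2 ^ m.+1 + t *+ 2 ^ m.+2.
Proof.
case: m => // m _; elim: m => [|m [t IH]]; first by exists 0; ring.
set z := y + y ^+ 2 in IH *.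
(* Read off from squaring 1 + 2^(m+2) (z + 2t). *)
exists (t + (z + t *+ 2) ^+ 2 *+ 2 ^ m).
rewrite (expnSr 2 m.+1) exprM IH !expnS.
by ring.
Qed.

(** The power 2^m gives 1 + 2^(m+1) z, whose square is 1, so a further odd exponent changes
    nothing. *)
Lemma pow_even_expansion m a (y : A) :
  (2 ^ m.+2)%:R = 0 :> A -> (0 < m)%N -> odd a ->
  (1 + y *+ 2) ^+ (2 ^ m * a) = 1 + (y + y ^+ 2) *+ 2 ^ m.+1.
Proof.
move=> A0 m0 oa; have P0 (x : A) : x *+ 2 ^ m.+2 = 0 by rewrite -mulr_natr A0 mulr0.
have [t Et] := pow2_expansion y m0.
rewrite exprM Et P0 addr0; set z := y + _.
have -> : a = (a./2 * 2).+1 by rewrite -{1}(odd_double_half a) oa -muln2.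
have Esq : (1 + z *+ 2 ^ m.+1) ^+ 2 = 1.
  have -> : (1 + z *+ 2 ^ m.+1) ^+ 2 =
    1 + (z + z ^+ 2 *+ 2 ^ m) *+ 2 ^ m.+2 by rewrite !expnS; ring.
  by rewrite P0 addr0.
by rewrite exprS mulnC exprM Esq expr1n mulr1.
Qed.

Lemma pow_odd_expansion s (y : A) : 4%:R = 0 :> A -> odd s ->
  (1 + y *+ 2) ^+ s = 1 + y *+ 2.
Proof.
move=> A0 os; have -> : s = (2 * s./2).+1 by rewrite -{1}(odd_double_half s) os -mul2n.
have E : (1 + y *+ 2) ^+ 2 = 1 + (y + y ^+ 2) * 4%:R by ring.
by rewrite exprS exprM E A0 mulr0 addr0 expr1n mulr1.
Qed.

End PowerExpansions.

(** * Congruences for [abar] at odd arguments *)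

Lemma abar_congr e s n (c : 'Z_(2 ^ e.+1)) : 0 < e -> odd n ->
  (forall y : {poly 'Z_(2 ^ e.+1)},
     (1 + y *+ 2) ^+ s = 1 + (y + c *: y ^+ 2) *+ 2 ^ e)%R ->
  abar s n = 2 ^ e * odd (ndiv n) %[mod 2 ^ e.+1].
Proof.
move=> e0 on pow_s.
have N1 : 1 < 2 ^ e.+1 by rewrite -{1}(expn0 2) ltn_exp2l.
have N0 : ((2 ^ e.+1)%:R = 0 :> 'Z_(2 ^ e.+1))%R by rewrite pchar_Zp.
have := abar_odd N0 e0 on pow_s; rewrite -/(ndiv n) -mulrnA.
move/(congr1 (@nat_of_ord _)); rewrite !val_Zp_nat // => ->.
rewrite -{1}(odd_double_half (ndiv n)) mulnDl -muln2 -mulnA -expnS.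
by rewrite addnC modnMDl mulnC.
Qed.

Lemma abarQ_congr e s p N (x : rat) :
  (forall n, odd n -> abar s n = 2 ^ e * odd (ndiv n) %[mod 2 ^ e.+1]) ->
  odd N -> odd p -> prime p -> p %| N -> (x * (p ^ 2)%:R = N%:R)%R ->
  abar s N = p ^ 2 * abarQ s x %[mod 2 ^ e.+1].
Proof.
move=> abarE oN op pp pN xE.
have p0 := prime_gt0 pp; rewrite abarE // /abarQ; case: ifP => xnat.
  have {xE}NE : N = p ^ 2 * Num.truncn x.
    apply/eqP; rewrite -(eqr_nat rat) natrM truncnK // mulrC xE.
    exact: eqxx.
  set M := Num.truncn x in NE *.
  have oM : odd M by move: oN; rewrite NE oddM => /andP[].
  rewrite -[in RHS]modnMmr abarE // modnMmr NE odd_ndiv_sqrM ?odd_gt0 //.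
  (* As p^2 is odd, multiplying 2^e b by it changes nothing modulo 2^(e+1). *)
  have -> : p ^ 2 = ((p ^ 2)./2 * 2).+1.
    by rewrite -{1}(odd_double_half (p ^ 2)) oddX op orbT -muln2.
  set h := (p ^ 2)./2; set b := nat_of_bool _.
  have -> : (h * 2).+1 * (2 ^ e * b) = h * b * 2 ^ e.+1 + 2 ^ e * b.
    by rewrite expnS; ring.
  by rewrite modnMDl.
(* Here [abarQ] is 0, and p^2 cannot divide [N], since otherwise x = N / p^2 would be a natural
   number. *)
rewrite muln0 (negbTE (@even_ndiv p N _ _ _ _)) ?muln0 ?odd_gt0 //.
apply: contraFN xnat => /dvdnP[M NM]; apply/natrP; exists M.
apply: (mulIf (x := ((p ^ 2)%:R)%R)); first by rewrite pnatr_eq0 expn_eq0 eqn0Ngt p0.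
by rewrite xE NM natrM.
Qed.

Theorem theorem1p4 (k n m alpha beta p r : nat)
    (hm : (1 <= m)%N) (halpha : (1 <= alpha)%N) (hbeta : (1 <= beta)%N)
    (halpha2 : ~~ (2 %| alpha)%N)
    (hp3 : (3 <= p)%N) (hp : prime p) (hp4 : p = 3 %[mod 4])
    (hr : (p %| 4 * r + 3)%N) :
  abar (2 ^ m * alpha) (4 * p ^ (k + 1) * n + 4 * p * r + 3 * p)
    = p ^ 2 * abarQ (2 ^ m * alpha)
        (4%:R * p%:R ^ (k%:Z - 1) * n%:R + (4 * r + 3)%:R / p%:R)%R
    %[mod 2 ^ (m + 2)]
  /\
  abar (2 * beta + 1) (4 * p ^ (k + 1) * n + 4 * p * r + 3 * p)
    = p ^ 2 * abarQ (2 * beta + 1)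
        (4%:R * p%:R ^ (k%:Z - 1) * n%:R + (4 * r + 3)%:R / p%:R)%R
    %[mod 4].
Proof.
have op : odd p by lia.
set N := 4 * p ^ (k + 1) * n + _ + _; set x := (_ + _)%R.
have oN : odd N by rewrite /N !oddD !oddM op.
have pN : p %| N.
  by apply/dvdnP; exists (4 * p ^ k * n + 4 * r + 3); rewrite /N expnD; ring.
have xE : (x * (p ^ 2)%:R = N%:R)%R.
  have p0 : (p%:R != 0 :> rat)%R by rewrite pnatr_eq0 -lt0n prime_gt0.
  (* The integer exponent k - 1 is -1 when k = 0, so it is split into a natural power and a
     division. *)
  have -> : x = (4%:R * (p%:R ^+ k / p%:R) * n%:R + (4 * r + 3)%:R / p%:R)%R.
    by rewrite /x expfzDr.
  rewrite /N !natrD !natrM !natrX exprD expr1.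
  by field.
rewrite addn2; split.
  (* Here e = m + 1 and c = 1; the second congruence takes e = 1 and c = 0. *)
  apply: abarQ_congr => // M oM; apply: (@abar_congr _ _ _ 1%R) => // y.
  rewrite scale1r pow_even_expansion //; last by rewrite dvdn2 negbK in halpha2.
  by rewrite -polyC_natr pchar_Zp // -{1}(expn0 2) ltn_exp2l.
apply: (@abarQ_congr 1) => // M oM; apply: (@abar_congr _ _ _ 0%R) => // y.
rewrite scale0r addr0 pow_odd_expansion //; last by rewrite addn1 /= mul2n odd_double.
by rewrite -polyC_natr (@pchar_Zp 4).
Qed.
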